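(* For every $n\ge5$, we have $\psi(K_n,-)=2$, where $(K_n,-)$ is the complete graph on $n$ vertices with all edges negative. Furthermore, for every $n\ge 5$ and every non-empty (not necessarily maximal) matching $M$ of $K_n$, we have $\psi(K_n-M,-)=3$, where $(K_n-M,-)$ is obtained from $(K_n,-)$ by removing the edges of $M$.
   Context: A signed graph $(G,\sigma)$ is a finite simple graph $G$ with a signature $\sigma:E(G)\to\{-,+\}$. Switching a set $S\subseteq V(G)$ changes the sign of every edge with exactly one end in $S$; two signed graphs on the same underlying graph are equivalent if one is obtained from the other by switching some set of vertices. For $k\ge1$ let $M_k=\{-n,\dots,-1,+1,\dots,+n\}$ if $k=2n$, and $M_k=\{-n,\dots,-1,\pm0,+1,\dots,+n\}$ if $k=2n+1$, where $\pm0$ is a single colour with $-(\pm0)=\pm0$. A $k$-colouring of $(G,\sigma)$ is a map $\phi:V(G)\to M_k$. Let $K_k^*$ be the signed multigraph with vertex set $\{i\ge 0: +i\in M_k\}$ (vertex $0$ standing for colour $\pm0$ when $k$ is odd), in which every two distinct vertices are joined by exactly one positive and one negative edge, and every vertex $i\neq0$ carries exactly one negative loop. Given a $k$-colouring $\phi$, the reduced signed graph $R(G,\sigma,\phi)$ is obtained by (1) switching every vertex with a negative colour $-i$ and recolouring it $+i$; (2) identifying, for each $i$, all vertices of colour $+i$ (resp. $\pm0$) into a single vertex $i$ (resp. $0$), edges inside a class becoming loops; (3) keeping at most one positive and at most one negative edge (or loop) between any two vertices (or at any vertex). The colouring $\phi$ is complete if $R(G,\sigma,\phi)$ is exactly $K_k^*$.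 The achromatic number $\psi(G,\sigma)$ is the largest $k\ge1$ such that some signed graph equivalent to $(G,\sigma)$ admits a complete $k$-colouring. *)

(* Defs.v *)
From mathcomp Require Import all_boot all_order all_algebra.

Set Implicit Arguments.
Unset Strict Implicit.
Unset Printing Implicit Defensive.

(* As in the convention (-1) ^+ b, [true] is the sign -, and the opposite of a
   sign is its boolean negation. *)
Definition sign := bool.
Definition pos : sign := false.
Definition neg : sign := true.

Record graph (T : finType) := Graph {
  edges : {set {set T}};
  card_edge : forall e, e \in edges -> #|e| = 2
}.

(* Only the values of a signature on the edges of the graph are meaningful;
   its values on other sets of vertices are never used. *)
Definition signature (T : finType) := {set T} -> sign.

Definition switch (T : finType) (S : {set T}) (sg : signature T) : signature T :=
  fun e => if #|e :&: S| == 1 then ~~ sg e else sg e.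

Definition equivalent (T : finType) (G : graph T) (sg sg' : signature T) : Prop :=
  exists S : {set T}, forall e, e \in edges G -> sg' e = switch S sg e.

(* The colour +-0 is the integer 0. *)
Definition colours (k : nat) : pred int :=
  fun c => (absz c <= k./2) && (odd k || (c != 0%R)).

Definition colouring (T : finType) (k : nat) (phi : T -> int) : Prop :=
  forall v, phi v \in colours k.

(* Signed multigraphs with vertices labelled by natural numbers:
   [mult H s i j] is the number of edges (loops if i = j) of sign s between
   i and j. *)
Record signed_multigraph := SignedMultigraph {
  verts : pred nat;
  mult : sign -> nat -> nat -> nat
}.

Definition same_multigraph (H H' : signed_multigraph) : Prop :=
  verts H =i verts H' /\
  forall s i j, i \in verts H -> j \in verts H -> mult H s i j = mult H' s i j.

Definition Kstar (k : nat) : signed_multigraph := {|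
  verts := fun i => Posz i \in colours k;
  mult := fun s i j =>
    if i != j then 1 else if (s == neg) && (i != 0) then 1 else 0
|}.

Definition identify (T : finType) (G : graph T) (sg : signature T)
    (lab : T -> nat) : signed_multigraph := {|
  verts := fun i => [exists v, lab v == i];
  mult := fun s i j =>
    #|[set e in edges G | (sg e == s) &&
        [exists u, exists v, [&& e == [set u; v], lab u == i & lab v == j]]]|
|}.

Definition simplify (H : signed_multigraph) : signed_multigraph := {|
  verts := verts H;
  mult := fun s i j => minn 1 (mult H s i j)
|}.

Definition reduced (T : finType) (G : graph T) (sg : signature T)
    (phi : T -> int) : signed_multigraph :=
  simplify (identify G (switch [set v | (phi v < 0)%R] sg)
                       (fun v => absz (phi v))).

Definition complete_colouring (T : finType) (G : graph T) (sg : signature T)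
    (k : nat) (phi : T -> int) : Prop :=
  colouring k phi /\ same_multigraph (reduced G sg phi) (Kstar k).

Definition completely_colourable (T : finType) (G : graph T)
    (sg : signature T) (k : nat) : Prop :=
  exists sg' : signature T, equivalent G sg sg' /\
    exists phi : T -> int, complete_colouring G sg' k phi.

(* psi(G, sg) = k *)
Definition achromatic_number (T : finType) (G : graph T) (sg : signature T)
    (k : nat) : Prop :=
  [/\ 1 <= k, completely_colourable G sg k &
      forall m, 1 <= m -> completely_colourable G sg m -> m <= k].

Lemma achromatic_number_uniq (T : finType) (G : graph T) (sg : signature T) k l :
  achromatic_number G sg k -> achromatic_number G sg l -> k = l.
Proof.
move=> [k0 ck mk] [l0 cl ml]; apply/eqP.
by rewrite eqn_leq ml // mk.
Qed.

Definition all_negative (T : finType) : signature T := fun=> neg.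

Lemma complete_card_edge (T : finType) (e : {set T}) :
  e \in [set e : {set T} | #|e| == 2] -> #|e| = 2.
Proof. by rewrite inE => /eqP. Qed.

Definition complete_graph (n : nat) : graph 'I_n :=
  Graph (@complete_card_edge 'I_n).

Lemma delete_card_edge (T : finType) (G : graph T) (M : {set {set T}}) e :
  e \in edges G :\: M -> #|e| = 2.
Proof. by rewrite inE => /andP[_]; apply: card_edge. Qed.

Definition delete_edges (T : finType) (G : graph T) (M : {set {set T}}) :
  graph T := Graph (@delete_card_edge T G M).

Definition matching (T : finType) (G : graph T) (M : {set {set T}}) : Prop :=
  M \subset edges G /\ trivIset M.

(* Main.v *)
Require Import Defs.
From mathcomp Require Import all_boot all_order all_algebra.

(** Up to switching, the signatures equivalent to the all-negative one are given
by a two-colouring [b] of the vertices, an edge being negative iff [b] agrees on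
its ends.  In a complete graph minus a matching, a vertex has at most one
non-neighbour.  A class of nonzero label has a negative edge [uv] but no positive
edge, so a vertex of the class on the other side of [b] would miss both [u] and
[v]: hence such a class is [b]-constant.  All edges between two [b]-constant
classes have the same sign, so at most one label is nonzero, and [psi <= 3].  If
[psi = 3], the class [0] is independent and not [b]-constant, so it contains a
non-edge; conversely the ends of a deleted edge, placed on opposite sides of [b],
form a suitable class [0]. *)

(** Here [lab] is the absolute value of the colour, and [b] merges the switching set with the set of
    negatively coloured vertices; [s = true] is the negative sign. *)
Definition complete_labelling {T : finType} (G : graph T) (k : nat)
    (lab : T -> nat) (b : T -> bool) : Prop :=
  (forall i, [exists v, lab v == i] = (Posz i \in colours k)) /\
  forall (s : bool) i j, Posz i \in colours k -> Posz j \in colours k ->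
    (exists u v, [/\ [set u; v] \in edges G, (b u == b v) = s,
                     lab u = i & lab v = j]) <->
    (i != j) || s && (i != 0).

(** This property covers both families of graphs, so that the bound [k <= 3] is proved once. *)
Definition at_most_one_nonneighbour {T : finType} (G : graph T) : Prop :=
  forall w u v, u != w -> v != w ->
    [set w; u] \notin edges G -> [set w; v] \notin edges G -> u = v.

Lemma edge_neq {T : finType} (G : graph T) u v :
  [set u; v] \in edges G -> u != v.
Proof. by move/card_edge/eqP; rewrite cards2; case: (u != v). Qed.

Lemma switch_pair {T : finType} (S : {set T}) (sg : signature T) u v :
  u != v ->
  switch S sg [set u; v] = sg [set u; v] (+) (u \in S) (+) (v \in S).
Proof.
move=> uv; rewrite /switch.
have -> : #|[set u; v] :&: S| = (u \in S) + (v \in S).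
  rewrite -sum1_card; under eq_bigl do rewrite inE.
  by rewrite big_mkcondr big_setU1 ?big_set1 ?inE.
by case: (u \in S); case: (v \in S); case: (sg _).
Qed.

Lemma mem_colours k i :
  (Posz i \in colours k) = (i <= k./2) && (odd k || (i != 0)).
Proof. by []. Qed.

(** After simplification a multiplicity is 0 or 1, hence the truth value of the existence of an
    edge. *)
Lemma mult_reducedP {T : finType} (G : graph T) sg (phi : T -> int)
    (b : T -> bool) s i j (c : bool) :
  (forall u v, [set u; v] \in edges G ->
     switch [set v | (phi v < 0)%R] sg [set u; v] = (b u == b v)) ->
  mult (reduced G sg phi) s i j = c <->
  ((exists u v, [/\ [set u; v] \in edges G, (b u == b v) = s,
                    absz (phi u) = i & absz (phi v) = j]) <-> c).
Proof.
move=> sgb; rewrite /=; set A := [set _ in _ | _].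
have -> : minn 1 #|A| = (A != set0) by rewrite -card_gt0; case: #|A| => [|[|]].
have AP : A != set0 <-> exists u v, [/\ [set u; v] \in edges G,
    (b u == b v) = s, absz (phi u) = i & absz (phi v) = j].
  split=> [/set0Pn[e]|[u [v [eG es ui vj]]]].
    rewrite !inE => /and3P[eG es /existsP[u /existsP[v]]].
    case/and3P=> /eqP ee /eqP ui /eqP vj; exists u, v; subst e.
    by split=> //; rewrite -sgb //; apply/eqP.
  apply/set0Pn; exists [set u; v]; rewrite !inE eG sgb // es eqxx /=.
  by apply/existsP; exists u; apply/existsP; exists v; rewrite eqxx ui vj !eqxx.
case: (A != set0) AP => -[AE EA]; case: c; split=> //.
- by case=> /(_ (AE isT)).
- by case=> _ /(_ isT)/EA.
Qed.

Lemma mult_Kstar k s i j :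
  mult (Kstar k) s i j = (i != j) || s && (i != 0) :> nat.
Proof. by rewrite /= /neg; case: (i != j); case: s; case: i. Qed.

Lemma completely_colourableP {T : finType} (G : graph T) k :
  completely_colourable G (@all_negative T) k <->
  exists lab b, complete_labelling G k lab b.
Proof.
split.
  case=> sg' [[S eqS]] [phi] [_ [eqV eqM]].
  exists (fun v => absz (phi v)), (fun v => (v \in S) (+) (phi v < 0)%R).
  split=> [i|s i j ik jk]; first exact: eqV i.
  apply/(mult_reducedP _ sg'); last first.
    by rewrite -(mult_Kstar k); apply: eqM; rewrite eqV; [exact: ik | exact: jk].
  move=> u v uvG; rewrite switch_pair ?(edge_neq _ _ _ uvG) // eqS //.
  rewrite switch_pair ?(edge_neq _ _ _ uvG) // !inE /all_negative /neg.
  by do 2![case: (_ \in S)]; do 2![case: (_ < 0)%R].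
(* Conversely, [b] is used entirely as a switching set and all colours are taken non-negative, so
   that the reduction switches nothing more. *)
case=> lab [b [eqV eqM]].
exists (switch [set v | b v] (@all_negative T)); split.
  by exists [set v | b v].
have noneg : [set v | (Posz (lab v) < 0)%R] = set0.
  by apply/setP=> v; rewrite !inE.
exists (fun v => Posz (lab v)); split; last split.
- by move=> v; rewrite -eqV; apply/existsP; exists v.
- exact: eqV.
move=> s i j iV jV; rewrite mult_Kstar.
apply/(mult_reducedP _ _ _ b); last first.
  by apply: eqM; rewrite -eqV; [exact: iV | exact: jV].
move=> u v uvG; rewrite noneg !switch_pair ?(edge_neq _ _ _ uvG) // !inE.
by rewrite /all_negative /neg; case: (b u); case: (b v).
Qed.

Lemma class_constant {T : finType} (G : graph T) k lab b i :
  at_most_one_nonneighbour G -> complete_labelling G k lab b ->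
  Posz i \in colours k -> i != 0 -> exists c, forall v, lab v = i -> b v = c.
Proof.
move=> nonG [_ eqM] ik i0.
(* The negative loop at [i] provides the edge [uv]. *)
have [_] := eqM true i i ik ik; rewrite eqxx i0 => /(_ isT).
case=> u [v [uvG /eqP buv lu lv]]; exists (b u) => w lw.
apply/eqP; apply/negPn/negP => bwu.
(* An edge [wx] would become a positive loop at [i]. *)
have nonw x : lab x = i -> b x = b u -> x != w /\ [set w; x] \notin edges G.
  move=> lx bx; split; first by apply: contraNneq bwu => <-; rewrite bx.
  apply/negP=> wxG; have [+ _] := eqM false i i ik ik.
  rewrite eqxx => H; suff: false by []; apply: H.
  by exists w, x; split=> //; apply/negbTE; rewrite bx.
have [uw wu] := nonw u lu erefl; have [vw wv] := nonw v lv (esym buv).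
by move: (edge_neq _ _ _ uvG); rewrite (nonG w u v) ?eqxx.
Qed.

Lemma constant_classes_eq {T : finType} (G : graph T) k lab b i j c d :
  complete_labelling G k lab b ->
  Posz i \in colours k -> Posz j \in colours k ->
  (forall v, lab v = i -> b v = c) -> (forall v, lab v = j -> b v = d) ->
  i = j.
Proof.
move=> [_ eqM] ik jk ci dj; apply/eqP/negPn/negP=> ij.
(* All edges between the two classes have sign [c == d], but an edge of the opposite sign is
   required too. *)
have [_] := eqM (c != d) i j ik jk; rewrite ij => /(_ isT).
case=> u [v [_ buv /ci cu /dj dv]].
by move: buv; rewrite cu dv; case: c d {ci dj cu dv} => [] [].
Qed.

Lemma completely_colourable_le3 {T : finType} (G : graph T) k :
  at_most_one_nonneighbour G ->
  completely_colourable G (@all_negative T) k -> k <= 3.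
Proof.
move=> nonG /completely_colourableP[lab [b cl]].
rewrite leqNgt; apply/negP=> k4.
(* From [k = 4] on, both [1] and [2] are labels. *)
have k2 : 1 < k./2 by apply: (half_leq (m := 4)).
have c1 : Posz 1 \in colours k by rewrite mem_colours ltnW ?orbT.
have c2 : Posz 2 \in colours k by rewrite mem_colours k2 orbT.
have [c ci] := class_constant _ _ _ _ _ nonG cl c1 isT.
have [d dj] := class_constant _ _ _ _ _ nonG cl c2 isT.
by have := constant_classes_eq _ _ _ _ _ _ _ _ cl c1 c2 ci dj.
Qed.

Lemma mem_delete_complete n (M : {set {set 'I_n}}) u v :
  ([set u; v] \in edges (delete_edges (complete_graph n) M)) =
  ([set u; v] \notin M) && (u != v).
Proof. by rewrite !inE cards2; case: (u != v). Qed.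

Lemma matching_at_most_one_nonneighbour n (M : {set {set 'I_n}}) :
  matching (complete_graph n) M ->
  at_most_one_nonneighbour (delete_edges (complete_graph n) M).
Proof.
move=> [_ /trivIsetP tM] w u v uw vw.
rewrite !mem_delete_complete ![w == _]eq_sym uw vw !andbT !negbK => wuM wvM.
(* Two deleted edges sharing [w] must coincide. *)
have [E|ne] := eqVneq [set w; u] [set w; v].
  have : u \in [set w; v] by rewrite -E !inE eqxx orbT.
  by rewrite !inE (negbTE uw) => /eqP.
have /pred0Pn[] := tM _ _ wuM wvM ne.
by exists w; rewrite /= !inE eqxx.
Qed.

Lemma complete_graph_at_most_one_nonneighbour n :
  at_most_one_nonneighbour (complete_graph n).
Proof. by move=> w u v uw _; rewrite !inE !cards2 ![w == _]eq_sym uw. Qed.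

(** Without a loop at [0], that class is independent, so it is a single vertex and [b] is constant
    on it, as on class [1]. *)
Lemma complete_not3 n :
  ~ completely_colourable (complete_graph n) (@all_negative 'I_n) 3.
Proof.
case/completely_colourableP=> lab [b cl].
have c0 : Posz 0 \in colours 3 by [].
have c1 : Posz 1 \in colours 3 by [].
have nonG := complete_graph_at_most_one_nonneighbour n.
have [c ci] := class_constant _ _ _ _ _ nonG cl c1 isT.
have [eqV eqM] := cl; have := eqV 0; rewrite c0 => /existsP[x /eqP lx].
suff di v : lab v = 0 -> b v = b x.
  by have := constant_classes_eq _ _ _ _ _ _ _ _ cl c0 c1 di ci.
move=> lv; have [->//|vx] := eqVneq v x.
suff: (0 != 0) || (b v == b x) && (0 != 0) by rewrite andbF.
by apply/(eqM _ _ _ c0 c0); exists v, x; split=> //; rewrite !inE cards2 vx.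
Qed.

Lemma complete_colourable2 n : 1 < n ->
  completely_colourable (complete_graph n) (@all_negative 'I_n) 2.
Proof.
case: n => [|[|n]] // _; apply/completely_colourableP.
(* The only label is [1], and a constant [b] keeps every edge negative. *)
exists (fun=> 1), (fun=> true); split.
  move=> i; rewrite mem_colours /=; apply/existsP/idP.
    by case=> _ /eqP<-.
  by case: i => [|[|]] //; exists ord0.
move=> s i j; rewrite !mem_colours.
case: i j => [|[|i]] // [|[|j]] // _ _; rewrite eqxx andbT /=; split.
  by case=> u [v [_ <-]].
by move=> ->; exists ord0, ord_max; split=> //; rewrite inE cards2.
Qed.

Lemma delete_matching_colourable3 n (M : {set {set 'I_n}}) :
  5 <= n -> matching (complete_graph n) M -> M != set0 ->
  completely_colourable (delete_edges (complete_graph n) M)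
                        (@all_negative 'I_n) 3.
Proof.
move=> n5 matM /set0Pn[e eM].
set G := delete_edges _ _.
have nonG : at_most_one_nonneighbour G := matching_at_most_one_nonneighbour _ _ matM.
have /cards2P[x [y [xy ee]]] : #|e| == 2.
  by have /subsetP/(_ e eM) := matM.1; rewrite inE.
have xyG : [set x; y] \notin edges G.
  by rewrite mem_delete_complete -ee eM.
(* The ends of [e] already miss each other, so they miss nothing else. *)
have adj u v : u \in e -> v \notin e ->
    [set u; v] \in edges G.
  rewrite ee !in_set2 negb_or => /orP[] /eqP-> /andP[vx vy];
    apply/negPn/negP=> vG.
    by move: vy; rewrite (nonG x v y) ?eqxx // eq_sym.
  by move: vx; rewrite (nonG y v x) ?eqxx // setUC.
(* Three vertices outside [e] suffice for an edge there, since [p] cannot miss both [q] and [r]; it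
   gives the negative loop at [1]. *)
have /card_gt2P[p [q [r [[p0 q0 r0] [pq qr rp]]]]] : 2 < #|~: e|.
  by rewrite cardsCs setCK card_ord ee cards2 xy ltn_subRL.
have [u [v [ue ve uvG]]] : exists u v, [/\ u \notin e, v \notin e &
    [set u; v] \in edges G].
  have [pqG|pqG] := boolP ([set p; q] \in edges G).
    by exists p, q; split; rewrite // -in_setC.
  exists p, r; split; rewrite -?in_setC //; apply/negPn/negP=> prG.
  by move: qr; rewrite (nonG p q r) ?eqxx // eq_sym.
apply/completely_colourableP.
exists (fun z => if z \in e then 0 else 1), (fun z => z != y).
have xe : x \in e by rewrite ee !inE eqxx.
have ye : y \in e by rewrite ee !inE eqxx orbT.
have pe : p \notin e by rewrite -in_setC.
have by1 z : z \notin e -> z != y by apply: contraNneq => ->.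
split=> [i|s i j].
  rewrite mem_colours /=; apply/existsP/idP.
    by case=> z /eqP <-; case: ifP.
  case: i => [|[|]] // _; first by exists x; rewrite xe.
  by exists p; rewrite (negbTE pe).
have lab0 z : (if z \in e then 0 else 1) = 0 -> z \in e by case: ifP.
have lab1 z : (if z \in e then 0 else 1) = 1 -> z \notin e by case: ifP.
rewrite !mem_colours; case: i j => [|[|i]] // [|[|j]] // _ _;
  rewrite ?andbF ?andbT; split=> //.
- case=> [z [t [ztG _ /lab0 ze /lab0 te]]].
  have zt := edge_neq _ _ _ ztG; move: ze te ztG zt xyG.
  rewrite ee !in_set2 => /orP[]/eqP-> /orP[]/eqP->; rewrite ?eqxx //.
    by move=> ->.
  by rewrite [[set y; x]]setUC => ->.
(* Since [b] is false at [y] only, [p] has a negative edge to [x] and a positive one to [y]. *)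
- move=> _; exists (if s then x else y), p; rewrite (negbTE pe) (by1 p pe).
  by case: s; rewrite ?xe ?ye ?xy ?eqxx; split=> //; apply: adj.
- move=> _; exists p, (if s then x else y); rewrite (negbTE pe) (by1 p pe).
  by rewrite setUC; case: s; rewrite ?xe ?ye ?xy ?eqxx; split=> //; apply: adj.
- by case=> [z [t [ztG <- /lab1/by1-> /lab1/by1->]]].
- by case: s => // _; exists u, v; rewrite uvG (negbTE ue) (negbTE ve) !by1 //; split.
Qed.

Theorem theorem2p11 :
  (forall n : nat, 5 <= n ->
     achromatic_number (complete_graph n) (@all_negative 'I_n) 2) /\
  (forall (n : nat) (M : {set {set 'I_n}}), 5 <= n ->
     matching (complete_graph n) M -> M != set0 ->
     achromatic_number (delete_edges (complete_graph n) M)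
                       (@all_negative 'I_n) 3).
Proof.
split=> [n n5|n M n5 matM M0]; split=> //.
- by apply: complete_colourable2; apply: leq_trans n5.
- move=> m _ cm.
  have := completely_colourable_le3 _ _ (complete_graph_at_most_one_nonneighbour n) cm.
  rewrite leq_eqVlt => /orP[/eqP m3|//].
  by rewrite m3 in cm; case: (complete_not3 n cm).
- exact: delete_matching_colourable3.
move=> m _; apply: completely_colourable_le3.
exact: matching_at_most_one_nonneighbour.
Qed.
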